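(* Let $A\in\mathbb{R}^{d\times n}$ have columns $a_1,\dots,a_n$, let $f:\mathbb{R}^d\to\mathbb{R}$ be convex and $L$-smooth, and let $\Box=\{x\in\mathbb{R}^n:0\le x_i\le1\ \forall i\}$. Let $x^\star$ be an optimal solution of $\min_{x\in\Box}f(Ax)$. Then for every $x\in\Box$ and every $i\in\{1,\dots,n\}$, $$a_i^\top\nabla f(Ax)-\|a_i\|_2\sqrt{2L\,G(x)}>0\ \Longrightarrow\ x_i^\star=0,$$ $$a_i^\top\nabla f(Ax)+\|a_i\|_2\sqrt{2L\,G(x)}<0\ \Longrightarrow\ x_i^\star=1,$$ where $G(x)$ is the duality gap.
   Context: $L$-smooth means differentiable with $L$-Lipschitz gradient in the Euclidean norm. The duality gap at $x$ of a problem $\min_x f(Ax)+g(x)$, with $f$ differentiable and $g$ closed convex, is $G(x)=f(Ax)+g(x)+f^*(w(x))+g^*(-A^\top w(x))$ with $w(x)=\nabla f(Ax)$, where $h^*(v)=\sup_u v^\top u-h(u)$ is the convex conjugate. Here $g=\iota_\Box$ is the indicator function of $\Box$ ($0$ on $\Box$, $+\infty$ outside), so $g^*(v)=\sup_{s\in\Box}s^\top v$. *)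

(* Defs.v *)
From HB Require Import structures.
From mathcomp Require Import all_boot all_order all_algebra.
From mathcomp Require Import all_classical all_reals all_analysis.

Set Implicit Arguments.
Unset Strict Implicit.
Unset Printing Implicit Defensive.

Import Order.TTheory GRing.Theory Num.Theory.
Import numFieldNormedType.Exports.

Local Open Scope classical_set_scope.
Local Open Scope ring_scope.

Definition dotv (R : realType) (m : nat) (u v : 'cV[R]_m) : R :=
  (u^T *m v) 0 0.

(* The library norm on matrices is the sup norm, hence a separate
   Euclidean norm. *)
Definition norm2 (R : realType) (m : nat) (u : 'cV[R]_m) : R :=
  Num.sqrt (\sum_(i < m) u i 0 ^+ 2).

Definition grad (R : realType) (m : nat) (f : 'cV[R]_m -> R) (y : 'cV[R]_m) :
    'cV[R]_m :=
  \col_i 'D_(delta_mx i 0) f y.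

(* Fréchet differentiability does not depend on the choice of norm in finite
   dimension, so the library's notion applies; only the Lipschitz bound has to
   mention the Euclidean norm. *)
Definition smooth_with (R : realType) (m : nat) (L : R) (f : 'cV[R]_m -> R) :
    Prop :=
  (forall y, differentiable f y) /\
  (forall y z, norm2 (grad f y - grad f z) <= L * norm2 (y - z)).

Definition conjugate (R : realType) (m : nat) (h : 'cV[R]_m -> \bar R)
    (v : 'cV[R]_m) : \bar R :=
  ereal_sup (range (fun u => ((dotv v u)%:E - h u)%E)).

(* The indicator function of convex analysis, not the 0/1-valued [\1_S]. *)
Definition indicator (R : realType) (m : nat) (S : set 'cV[R]_m)
    (x : 'cV[R]_m) : \bar R :=
  if x \in S then 0%E else +oo%E.

Definition duality_gap (R : realType) (d n : nat) (A : 'M[R]_(d, n))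
    (f : 'cV[R]_d -> R) (g : 'cV[R]_n -> \bar R) (x : 'cV[R]_n) : \bar R :=
  let w := grad f (A *m x) in
  ((f (A *m x))%:E + g x + conjugate (EFin \o f) w
     + conjugate g (- (A^T *m w))%R)%E.

Definition unit_box (R : realType) (n : nat) : set 'cV[R]_n :=
  [set x | forall i, 0 <= x i 0 <= 1].
Arguments unit_box : clear implicits.

Definition minimizer_on (R : realType) (T : Type) (S : set T) (h : T -> R)
    (x : T) : Prop :=
  S x /\ forall y, S y -> h x <= h y.

(* Main.v *)
(* Let z be an optimal solution, and write w and w' for the gradients of f at
   Ax and Az. Inserting u = Ax in f^* and s = z in g^* shows
   G(x) >= w^T (Ax - Az). Convexity and L-smoothness give
   f(Az) >= f(Ax) + w^T (Az - Ax) + |w - w'|^2 / (2L), and f(Az) <= f(Ax), so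
   |w - w'|^2 <= 2 L G(x). By Cauchy-Schwarz the hypothesis on a_i^T w then
   fixes the sign of a_i^T w', and first-order optimality of z in the i-th
   coordinate forces z_i to the corresponding bound. When L <= 0 the Lipschitz
   condition alone forces w = w'. *)
Require Import Defs.
From HB Require Import structures.
From mathcomp Require Import all_boot all_order all_algebra.
From mathcomp Require Import all_classical all_reals all_analysis.
From mathcomp Require Import ring lra.
Set Implicit Arguments.
Unset Strict Implicit.
Unset Printing Implicit Defensive.

Import Order.TTheory GRing.Theory Num.Theory.
Import numFieldNormedType.Exports.
Local Open Scope classical_set_scope.
Local Open Scope ring_scope.

(** * Euclidean inner product and norm *)

Section Dot.
Context (R : realType) (m : nat).
Implicit Types (u v w : 'cV[R]_m) (a : R).

Lemma dotvE u v : dotv u v = \sum_j u j 0 * v j 0.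
Proof. by rewrite /dotv mxE; apply: eq_bigr => j _; rewrite mxE. Qed.

Lemma dotvC u v : dotv u v = dotv v u.
Proof. by rewrite !dotvE; apply: eq_bigr => j _; rewrite mulrC. Qed.

Lemma dotvDr u v w : dotv u (v + w) = dotv u v + dotv u w.
Proof. by rewrite /dotv mulmxDr mxE. Qed.

Lemma dotvZr a u v : dotv u (a *: v) = a * dotv u v.
Proof. by rewrite /dotv -scalemxAr mxE. Qed.

Lemma dotvNr u v : dotv u (- v) = - dotv u v.
Proof. by rewrite /dotv mulmxN mxE. Qed.

Lemma dotvBr u v w : dotv u (v - w) = dotv u v - dotv u w.
Proof. by rewrite dotvDr dotvNr. Qed.

Lemma dotvBl u v w : dotv (u - v) w = dotv u w - dotv v w.
Proof. by rewrite -!(dotvC w) dotvBr. Qed.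

Lemma norm2_ge0 u : 0 <= norm2 u.
Proof. exact: sqrtr_ge0. Qed.

Lemma sqr_norm2 u : norm2 u ^+ 2 = dotv u u.
Proof.
rewrite sqr_sqrtr ?dotvE; last by apply: sumr_ge0 => j _; rewrite sqr_ge0.
by apply: eq_bigr => j _; rewrite expr2.
Qed.

Lemma norm2Z a u : 0 <= a -> norm2 (a *: u) = a * norm2 u.
Proof.
move=> a0; apply/eqP; rewrite -(@eqrXn2 _ 2) ?norm2_ge0 ?mulr_ge0 ?norm2_ge0//.
by rewrite exprMn !sqr_norm2 dotvZr dotvC dotvZr mulrA.
Qed.

Lemma norm2N u : norm2 (- u) = norm2 u.
Proof.
by congr Num.sqrt; apply: eq_bigr => j _; rewrite mxE sqrrN.
Qed.

Lemma norm2_eq0 u : norm2 u = 0 -> u = 0.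
Proof.
move=> nu; have := sqr_norm2 u; rewrite nu expr0n/= dotvE => /esym/eqP.
rewrite psumr_eq0 => [/allP u0|j _]; last by rewrite -expr2 sqr_ge0.
apply/matrixP => j k; rewrite ord1 !mxE; apply/eqP.
by have := u0 j (mem_index_enum j); rewrite mulf_eq0 orbb.
Qed.

Lemma dotv0 u : dotv u 0 = 0.
Proof. by rewrite -(scale0r 0) dotvZr mul0r. Qed.

(** For nonzero vectors, the square of the norm of [norm2 v *: u - norm2 u *: v] expands to
    [2 * (a * b * (a * b - c))], and the positive factor [a * b] cancels. *)
Lemma cauchy_schwarz u v : dotv u v <= norm2 u * norm2 v.
Proof.
have [/norm2_eq0->|nu] := eqVneq (norm2 u) 0.
  by rewrite dotvC dotv0 mulr_ge0 ?norm2_ge0.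
have [/norm2_eq0->|nv] := eqVneq (norm2 v) 0.
  by rewrite dotv0 mulr_ge0 ?norm2_ge0.
have := sqr_ge0 (norm2 (norm2 v *: u - norm2 u *: v)).
rewrite sqr_norm2 dotvBr !dotvBl !dotvZr !(dotvC (_ *: _)) !dotvZr (dotvC v u).
rewrite -!sqr_norm2.
have a0 : 0 < norm2 u by rewrite lt_def nu norm2_ge0.
have b0 : 0 < norm2 v by rewrite lt_def nv norm2_ge0.
have ab0 := mulr_gt0 a0 b0.
set a := norm2 u in ab0 *; set b := norm2 v in ab0 *; set c := dotv u v.
rewrite (_ : _ - _ = 2 * (a * b * (a * b - c))); last by ring.
by rewrite pmulr_rge0// pmulr_rge0// subr_ge0.
Qed.
End Dot.

(** * Gradients and directional derivatives *)

Section Gradient.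
Context (R : realType) (m : nat) (f : 'cV[R]_m -> R).
Implicit Types (u v w x y z : 'cV[R]_m).

(** [grad] only records partial derivatives; linearity of the differential extends them to every
    direction. *)
Lemma deriveE_grad x v : differentiable f x -> 'D_v f x = dotv (grad f x) v.
Proof.
move=> df; rewrite deriveE//.
have {1}-> : v = \sum_j v j 0 *: delta_mx j 0.
  by rewrite [LHS]matrix_sum_delta; apply: eq_bigr => j _; rewrite big_ord1.
rewrite linear_sum dotvE; apply: eq_bigr => j _.
by rewrite linearZ mxE deriveE//= mulrC.
Qed.

Lemma is_derive_line x v (t : R) : differentiable f (x + t *: v) ->
  is_derive t 1 (fun s => f (x + s *: v)) (dotv (grad f (x + t *: v)) v).
Proof.
move=> df; rewrite -deriveE_grad//.
have E : (fun h : R => h^-1 *: (((fun s => f (x + s *: v)) \o shift t) (h *: 1)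
            - f (x + t *: v))) =
         (fun h => h^-1 *: ((f \o shift (x + t *: v)) (h *: v)
            - f (x + t *: v))).
  apply/funext => h /=; congr (_ *: (f _ - _)).
  by rewrite [h *: 1]mulr1 scalerDl addrCA.
split; first by rewrite /derivable E; exact: diff_derivable.
by rewrite /derive E.
Qed.

End Gradient.

(** The derivative is also the limit from the right, where all difference quotients are nonnegative
    near [a]. This is the source of both the tangent inequality and first-order optimality. *)
Lemma derive_ge0_at_right_min (R : realType) (k : R -> R) (a l e : R) :
  0 < e -> is_derive a 1 k l ->
  (forall t, 0 < t < e -> k a <= k (a + t)) -> 0 <= l.
Proof.
move=> e0 [dk <-] ka.
have /cvg_dnbhs_at_right dk' : h^-1 *: ((k \o shift a) (h *: 1) - k a)
   @[h --> 0^'] --> 'D_1 k a by exact: dk.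
have <- := cvg_lim _ dk'; last exact: norm_hausdorff.
apply: limr_ge; first by apply/cvg_ex; exists ('D_1 k a).
near=> h.
have h0 : 0 < h by near: h; exact: nbhs_right_gt.
have he : h < e by near: h; exact: nbhs_right_lt.
apply: mulr_ge0; first by rewrite invr_ge0 ltW.
by rewrite subr_ge0 /= [h *: 1]mulr1 addrC ka// h0 he.
Unshelve. all: by end_near. Qed.

(** * Bounds for convex and smooth functions *)

Section Convex.
Context (R : realType) (m : nat) (f : 'cV[R]_m -> R).
Implicit Types (u v w x y z : 'cV[R]_m).

(** Along the segment from [x] to [y], the chord of [f] minus [f] is nonnegative and vanishes at
    [x], so its derivative there is nonnegative. *)
Lemma convex_tangent x y :
  convex_function [set: convex_lmodType 'cV[R]_m] f -> differentiable f x ->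
  f x + dotv (grad f x) (y - x) <= f y.
Proof.
move=> fc df; rewrite addrC -lerBrDr -subr_ge0.
have dl : is_derive (0 : R) 1 (fun s => f (x + s *: (y - x)))
    (dotv (grad f x) (y - x)).
  by rewrite -[x in grad _ x]addr0 -[X in x + X](scale0r (y - x));
    apply: is_derive_line; rewrite scale0r addr0.
apply: (@derive_ge0_at_right_min _
   (fun s => s * (f y - f x) - f (x + s *: (y - x))) 0 _ 1) => //.
  apply: is_derive_eq; last by rewrite /GRing.scale /=; ring.
move=> t /andP[t0 t1]; rewrite mul0r scale0r addr0 add0r.
(* The weight [t] falls on the first argument, so the order [y], [x] yields the point
   [x + t *: (y - x)]. *)
have := fc (Itv01 (ltW t0) (ltW t1)) y x; rewrite !in_setT => /(_ isT isT).
rewrite convRE /=.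
have -> : conv (Itv01 (ltW t0) (ltW t1))
   (y : convex_lmodType 'cV[R]_m) (x : convex_lmodType 'cV[R]_m) =
   x + t *: (y - x) :> 'cV[R]_m.
  change (t *: y + (1 - t) *: x = x + t *: (y - x)).
  by rewrite scalerBl scale1r scalerBr addrCA.
by rewrite add0r /unstable.onem; lra.
Qed.

(** The difference [h] of the two sides along the segment is nonincreasing: by Cauchy-Schwarz and
    the Lipschitz bound, the gradient term in its derivative is at most [L * t * norm2 v ^+ 2],
    which is what the quadratic term subtracts. *)
Lemma smooth_descent L x v : smooth_with L f ->
  f (x + v) <= f x + dotv (grad f x) v + L / 2 * norm2 v ^+ 2.
Proof.
move=> [df lf]; set c := dotv (grad f x) v; set q := L / 2 * norm2 v ^+ 2.
pose h (t : R) := f (x + t *: v) - t * c - q * t ^+ 2.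
have dh (t : R) : is_derive t 1 h
    (dotv (grad f (x + t *: v)) v - c - q * (2 * t)).
  have dl := is_derive_line (df (x + t *: v)).
  by apply: is_derive_eq; rewrite /GRing.scale /=; ring.
have dh1 (t : R) : derivable h t 1 by case: (dh t).
have h0 (t : R) : t \in `]0, 1[ -> derive1 h t <= 0.
  rewrite in_itv/= => /andP[t0 _]; rewrite derive1E derive_val.
  rewrite -dotvBl; have := cauchy_schwarz (grad f (x + t *: v) - grad f x) v.
  have := ler_wpM2r (norm2_ge0 v) (lf (x + t *: v) x).
  rewrite addrAC subrr add0r norm2Z ?(ltW t0)// /q.
  by set a := norm2 v; lra.
have ch : {within `[0, 1], continuous h}.
  by apply: derivable_within_continuous => t _; exact: dh1.
have : h 1 <= h 0.
  by apply: (ler0_derive1_le_cc (fun t _ => dh1 t) h0 ch);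
    rewrite ?in_itv/= ?lexx ?ler01.
rewrite /h scale1r scale0r addr0; lra.
Qed.

(* Compare the tangent at [x] with the descent bound at [y], both evaluated at
   [y - L^-1 *: (grad f y - grad f x)], the gradient step from [y] for the
   function [f - dotv (grad f x)], which is minimal at [x]. *)
Lemma convex_smooth_tangent L x y : 0 < L ->
  convex_function [set: convex_lmodType 'cV[R]_m] f -> smooth_with L f ->
  f x + dotv (grad f x) (y - x) + norm2 (grad f x - grad f y) ^+ 2 / (2 * L)
    <= f y.
Proof.
move=> L0 fc fs; have L'0 : L != 0 by rewrite gt_eqF.
pose p := grad f x - grad f y.
have := convex_tangent (y + L^-1 *: p) fc (fs.1 x).
have := smooth_descent y (L^-1 *: p) fs.
rewrite norm2Z ?invr_ge0 ?(ltW L0)// [y + _ - x]addrAC.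
rewrite [dotv _ (_ + L^-1 *: p)]dotvDr !dotvZr exprMn.
have : dotv (grad f x) p - dotv (grad f y) p = norm2 p ^+ 2.
  by rewrite -dotvBl sqr_norm2.
rewrite -/p; set q := norm2 p ^+ 2.
have -> : L / 2 * (L^-1 ^+ 2 * q) = L^-1 * q / 2 by field.
have -> : q / (2 * L) = L^-1 * q / 2 by field.
move=> <-; lra.
Qed.
End Convex.

(** * First-order optimality on the box *)

Section BoxMinimizer.
Context (R : realType) (d n : nat) (A : 'M[R]_(d, n)) (f : 'cV[R]_d -> R).
Context (z : 'cV[R]_n) (df : differentiable f (A *m z)).
Context (zopt : minimizer_on (unit_box R n) (fun x => f (A *m x)) z).

(** The segment from [z] to [y] stays in the box, so [f] along its image under [A] is minimal at the
    start. *)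
Lemma box_min_variational y : unit_box R n y ->
  0 <= dotv (grad f (A *m z)) (A *m (y - z)).
Proof.
move=> yb.
have dl : is_derive (0 : R) 1 (fun s => f (A *m z + s *: (A *m (y - z))))
    (dotv (grad f (A *m z)) (A *m (y - z))).
  by rewrite -[X in grad _ X]addr0 -[X in _ *m _ + X](scale0r (A *m (y - z)));
    apply: is_derive_line; rewrite scale0r addr0.
apply: (derive_ge0_at_right_min ltr01 dl) => t /andP[t0 t1].
rewrite scale0r addr0 add0r scalemxAr -mulmxDr; apply: zopt.2 => j.
by have := yb j; have := zopt.1 j; rewrite !mxE; nra.
Qed.

(** Only the [i]-th coordinate of [z] is moved, to the value [a]; the direction is then mapped by
    [A] to a multiple of [col i A]. *)
Lemma box_min_coord i (a : R) : 0 <= a <= 1 ->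
  0 <= (a - z i 0) * dotv (col i A) (grad f (A *m z)).
Proof.
move=> a01.
have : unit_box R n (z + (a - z i 0) *: delta_mx i 0).
  move=> j; rewrite !mxE eqxx andbT; case: eqVneq => [->|_] /=.
    by rewrite mulr1 addrC subrK.
  by rewrite mulr0 addr0; exact: zopt.1.
move=> /box_min_variational; rewrite addrAC subrr add0r -scalemxAr dotvZr.
by rewrite -colE dotvC.
Qed.
End BoxMinimizer.

(** * Gradient error bounded by the duality gap *)

Lemma duality_gap_ge (R : realType) (d n : nat) (A : 'M[R]_(d, n))
    (f : 'cV[R]_d -> R) (S : set 'cV[R]_n) (x z : 'cV[R]_n) : S x -> S z ->
  ((dotv (grad f (A *m x)) (A *m (x - z)))%:E
     <= duality_gap A f (indicator S) x)%E.
Proof.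
move=> Sx Sz; set w := grad f (A *m x).
have c1 : ((dotv w (A *m x) - f (A *m x))%:E <= conjugate (EFin \o f) w)%E.
  by apply: ereal_sup_ubound; exists (A *m x).
have c2 : ((- dotv w (A *m z))%:E <= conjugate (indicator S) (- (A^T *m w)))%E.
  apply: ereal_sup_ubound; exists z => //.
  rewrite /indicator mem_set// sube0; congr EFin.
  by rewrite /dotv linearN/= trmx_mul trmxK mulNmx mulmxA mxE.
rewrite /duality_gap -/w {1}/indicator mem_set// adde0.
apply: le_trans (leeD (leeD (lexx _) c1) c2).
by rewrite -!EFinD lee_fin mulmxBr dotvBr; lra.
Qed.

Lemma norm2_grad_le_gap (R : realType) (d n : nat) (A : 'M[R]_(d, n))
    (f : 'cV[R]_d -> R) (L : R) (S : set 'cV[R]_n) (x z : 'cV[R]_n) :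
  convex_function [set: convex_lmodType 'cV[R]_d] f -> smooth_with L f ->
  minimizer_on S (fun x => f (A *m x)) z -> S x ->
  ((norm2 (grad f (A *m x) - grad f (A *m z)))%:E
     <= sqrte ((2 * L)%:E * duality_gap A f (indicator S) x))%E.
Proof.
move=> fc fs [Sz zmin] Sx; set p := grad f _ - _.
(* For [L <= 0] the left side is at most 0, while [sqrte] is nonnegative even on negative
   arguments. *)
have [L0|L0] := leP L 0.
  apply: le_trans (sqrte_ge0 _); rewrite lee_fin.
  by apply: le_trans (fs.2 _ _) _; rewrite mulr_le0_ge0 ?norm2_ge0.
have pG : ((norm2 p ^+ 2)%:E <= (2 * L)%:E * duality_gap A f (indicator S) x)%E.
  have L2 : 0 <= 2 * L by lra.
  apply: le_trans (lee_wpmul2l _ (duality_gap_ge A f Sx Sz));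
    last by rewrite lee_fin.
  rewrite -EFinM lee_fin mulrC -ler_pdivrMr; last by lra.
  have := convex_smooth_tangent (A *m x) (A *m z) L0 fc fs.
  have := zmin _ Sx; rewrite -/p mulmxBr !dotvBr; lra.
have p2 : (0 <= (norm2 p ^+ 2)%:E)%E by rewrite lee_fin sqr_ge0.
(* Taking roots requires a nonnegative right side, which follows from [p2] and [pG]. *)
have := pG; rewrite -lee_sqrt ?(le_trans p2)//=.
by rewrite sqrtr_sqr ger0_norm ?norm2_ge0.
Qed.

Theorem theorem14 (R : realType) (d n : nat) (A : 'M[R]_(d, n))
    (f : 'cV[R]_d -> R) (L : R) (xstar : 'cV[R]_n)
    (f_convex : convex_function [set: convex_lmodType 'cV[R]_d] f)
    (f_smooth : smooth_with L f)
    (xstar_opt : minimizer_on (unit_box R n) (fun x => f (A *m x)) xstar)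
    (x : 'cV[R]_n) (x_box : unit_box R n x) (i : 'I_n) :
  let G := duality_gap A f (indicator (unit_box R n)) x in
  let s := (dotv (col i A) (grad f (A *m x)))%:E in
  let r := ((norm2 (col i A))%:E * sqrte ((2 * L)%:E * G))%E in
  ((0 < s - r)%E -> xstar i 0 = 0) /\ ((s + r < 0)%E -> xstar i 0 = 1).
Proof.
move=> G s r; pose a := col i A; pose w := grad f (A *m x).
pose w' := grad f (A *m xstar).
(* A real lower bound for the extended real [r] moves both hypotheses into [R]. *)
have rE : ((norm2 a * norm2 (w - w'))%:E <= r)%E.
  rewrite EFinM; apply: lee_wpmul2l; first by rewrite lee_fin norm2_ge0.
  exact: norm2_grad_le_gap.
have opt := box_min_coord (f_smooth.1 _) xstar_opt i.
have /andP[z0 z1] := xstar_opt.1 i.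
split=> h.
- have a0 : 0 < dotv a w'.
    have : (0 < s - (norm2 a * norm2 (w - w'))%:E)%E.
      by apply: lt_le_trans h _; rewrite leeB.
    rewrite -EFinB lte_fin; have := cauchy_schwarz a (w - w').
    by rewrite dotvBr; lra.
  (* Moving the coordinate to 0 gives [- xstar i 0 * dotv a w' >= 0], so the positive factor forces
     [xstar i 0 <= 0]. *)
  by have := opt 0; rewrite lexx ler01 => /(_ isT); rewrite -/a -/w'; nra.
- have a0 : dotv a w' < 0.
    have : (s + (norm2 a * norm2 (w - w'))%:E < 0)%E.
      by apply: le_lt_trans h; rewrite leeD2l.
    (* The negated vector turns Cauchy-Schwarz into an upper bound on [dotv a w' - dotv a w]. *)
    rewrite -EFinD lte_fin; have := cauchy_schwarz a (- (w - w')).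
    by rewrite norm2N dotvNr dotvBr; lra.
  by have := opt 1; rewrite lexx ler01 => /(_ isT); rewrite -/a -/w'; nra.
Qed.
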